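(* Any finitely complete $\mathbb P_{\mathbb E}$-decomposable category $\mathbb{E}$ is a Mal'tsev category.
   Context: $\mathrm{Pt}\,\mathbb{E}$ is the category whose objects are the split epimorphisms $(f,s):X\rightleftarrows Y$, $f.s=1_Y$, with chosen splitting, and whose maps $(y,x):(f',s')\to(f,s)$ are pairs with $f.x=y.f'$ and $x.s'=s.y$. $\mathbb P_{\mathbb E}:\mathrm{Pt}\,\mathbb E\to\mathbb E$ sends $(f,s)$ to the codomain of $f$; $(y,x)$ is $\mathbb P_{\mathbb E}$-cartesian iff $f.x=y.f'$ is a pullback square. A decomposition $v=w.u$ of a monomorphism $v:U\rightarrowtail T$ of $\mathrm{Pt}\,\mathbb E$, with $u:U\to X$ $\mathbb P_{\mathbb E}$-cartesian, is $\mathbb P_{\mathbb E}$-extremal when for any other decomposition $v=w'.u'$ with $u':U\to X'$ $\mathbb P_{\mathbb E}$-cartesian there is a unique $t:X'\to X$ with $w.t=w'$ and $t.u'=u$. $\mathbb E$ is $\mathbb P_{\mathbb E}$-decomposable when every monomorphism of $\mathrm{Pt}\,\mathbb E$ has a $\mathbb P_{\mathbb E}$-extremal decomposition. A Mal'tsev category is a (finitely complete) category in which any reflexive relation is an equivalence relation. *)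

(* Defs.v *)
From Stdlib Require Import FinFun ProofIrrelevance.

Set Implicit Arguments.
Unset Strict Implicit.
Unset Printing Implicit Defensive.

(** * Categories, functors, finite limits *)

Declare Scope cat_scope.
Delimit Scope cat_scope with cat.
Local Open Scope cat_scope.

Record category := Category {
  ob :> Type;
  hom : ob -> ob -> Type;
  idm : forall X, hom X X;
  comp : forall X Y Z, hom Y Z -> hom X Y -> hom X Z;
  comp1m : forall X Y (f : hom X Y), comp (idm Y) f = f;
  compm1 : forall X Y (f : hom X Y), comp f (idm X) = f;
  compA : forall X Y Z W (h : hom Z W) (g : hom Y Z) (f : hom X Y),
    comp h (comp g f) = comp (comp h g) f
}.

Arguments hom {c} X Y.
Arguments idm {c} X.
Arguments comp {c X Y Z} g f.

Notation "g ∘ f" := (comp g f) (at level 40, left associativity) : cat_scope.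

Record functor (A B : category) := Functor {
  fob :> A -> B;
  fmap : forall X Y, hom X Y -> hom (fob X) (fob Y);
  fmap1 : forall X, fmap (idm X) = idm (fob X);
  fmapM : forall X Y Z (g : hom Y Z) (f : hom X Y),
    fmap (g ∘ f) = fmap g ∘ fmap f
}.

Arguments fmap {A B} F {X Y} f : rename.

Definition finite_category (J : category) : Prop :=
  Finite J /\ forall i j : J, Finite (hom i j).

Section Limits.
Variables (J E : category) (D : functor J E).

Definition is_cone (L : E) (p : forall j, hom L (D j)) : Prop :=
  forall i j (a : hom i j), fmap D a ∘ p i = p j.

Definition is_limit (L : E) (p : forall j, hom L (D j)) : Prop :=
  is_cone p /\
  forall (T : E) (q : forall j, hom T (D j)), is_cone q ->
    exists! h : hom T L, forall j, p j ∘ h = q j.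
End Limits.

Definition finitely_complete (E : category) : Prop :=
  forall (J : category) (D : functor J E), finite_category J ->
    exists (L : E) (p : forall j, hom L (D j)), is_limit p.

Section Morphisms.
Variable E : category.

Definition mono (X Y : E) (m : hom X Y) : Prop :=
  forall (T : E) (a b : hom T X), m ∘ a = m ∘ b -> a = b.

Definition is_pullback (P A B C : E) (p : hom P A) (q : hom P B)
    (f : hom A C) (g : hom B C) : Prop :=
  f ∘ p = g ∘ q /\
  forall (T : E) (a : hom T A) (b : hom T B), f ∘ a = g ∘ b ->
    exists! h : hom T P, p ∘ h = a /\ q ∘ h = b.

(** * Internal relations and Mal'tsev categories *)

Definition is_relation (R X : E) (d0 d1 : hom R X) : Prop :=
  forall (T : E) (a b : hom T R),
    d0 ∘ a = d0 ∘ b -> d1 ∘ a = d1 ∘ b -> a = b.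

Definition reflexive_rel (R X : E) (d0 d1 : hom R X) : Prop :=
  exists s0 : hom X R, d0 ∘ s0 = idm X /\ d1 ∘ s0 = idm X.

Definition symmetric_rel (R X : E) (d0 d1 : hom R X) : Prop :=
  exists c : hom R R, d0 ∘ c = d1 /\ d1 ∘ c = d0.

(* [P] is the object of composable pairs x R y R z; only meaningful when the
   pullback of [d1] along [d0] exists. *)
Definition transitive_rel (R X : E) (d0 d1 : hom R X) : Prop :=
  forall (P : E) (p0 p1 : hom P R), is_pullback p0 p1 d1 d0 ->
    exists c : hom P R, d0 ∘ c = d0 ∘ p0 /\ d1 ∘ c = d1 ∘ p1.

Definition reflexive_relation (R X : E) (d0 d1 : hom R X) : Prop :=
  is_relation d0 d1 /\ reflexive_rel d0 d1.

Definition equivalence_relation (R X : E) (d0 d1 : hom R X) : Prop :=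
  is_relation d0 d1 /\ reflexive_rel d0 d1 /\
  symmetric_rel d0 d1 /\ transitive_rel d0 d1.
End Morphisms.

Definition maltsev_category (E : category) : Prop :=
  finitely_complete E /\
  forall (R X : E) (d0 d1 : hom R X),
    reflexive_relation d0 d1 -> equivalence_relation d0 d1.

(** * Extremal decompositions with respect to a functor *)

Section Decomposable.
Variables (A B : category) (P : functor A B).

Definition cartesian (X Y : A) (u : hom X Y) : Prop :=
  forall (Z : A) (g : hom Z Y) (k : hom (P Z) (P X)),
    fmap P u ∘ k = fmap P g ->
    exists! h : hom Z X, fmap P h = k /\ u ∘ h = g.

Definition decomposition (U T : A) (v : hom U T)
    (X : A) (u : hom U X) (w : hom X T) : Prop :=
  v = w ∘ u /\ cartesian u.

(* [w] and [w'] are not required to be monomorphisms. *)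
Definition extremal_decomposition (U T : A) (v : hom U T)
    (X : A) (u : hom U X) (w : hom X T) : Prop :=
  decomposition v u w /\
  forall (X' : A) (u' : hom U X') (w' : hom X' T), decomposition v u' w' ->
    exists! t : hom X' X, w ∘ t = w' /\ t ∘ u' = u.

Definition decomposable : Prop :=
  forall (U T : A) (v : hom U T), mono v ->
    exists (X : A) (u : hom U X) (w : hom X T), extremal_decomposition v u w.
End Decomposable.

(** * The category of points and its fibration *)

Section Points.
Variable E : category.

Record point := Point {
  pt_dom : E;
  pt_cod : E;
  pt_epi : hom pt_dom pt_cod;
  pt_sec : hom pt_cod pt_dom;
  pt_split : pt_epi ∘ pt_sec = idm pt_cod
}.

Record point_hom (p' p : point) := PointHom {
  ph_cod : hom (pt_cod p') (pt_cod p);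
  ph_dom : hom (pt_dom p') (pt_dom p);
  ph_epi : pt_epi p ∘ ph_dom = ph_cod ∘ pt_epi p';
  ph_sec : ph_dom ∘ pt_sec p' = pt_sec p ∘ ph_cod
}.

Lemma point_hom_eq (p' p : point) (h k : point_hom p' p) :
  ph_cod h = ph_cod k -> ph_dom h = ph_dom k -> h = k.
Proof.
destruct h as [y x e s], k as [y2 x2 e2 s2]; simpl; intros -> ->.
f_equal; apply proof_irrelevance.
Qed.

Definition point_id (p : point) : point_hom p p.
Proof.
refine (@PointHom p p (idm _) (idm _) _ _).
- now rewrite compm1, comp1m.
- now rewrite compm1, comp1m.
Defined.

Definition point_comp (p q r : point) (k : point_hom q r) (h : point_hom p q) :
  point_hom p r.
Proof.
refine (@PointHom p r (ph_cod k ∘ ph_cod h) (ph_dom k ∘ ph_dom h) _ _).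
- now rewrite compA, ph_epi, <- compA, ph_epi, compA.
- now rewrite <- compA, ph_sec, compA, ph_sec, compA.
Defined.

Definition Pt : category.
Proof.
refine (@Category point point_hom point_id point_comp _ _ _); intros;
  apply point_hom_eq; simpl; auto using comp1m, compm1, compA.
Defined.

Definition Pt_cod : functor Pt E.
Proof.
now refine (@Functor Pt E pt_cod ph_cod _ _).
Defined.

(* Cartesianness for [Pt_cod] in terms of pullback squares. *)
Lemma cartesian_Pt_codP (p' p : Pt) (h : hom p' p) :
  (exists (Q : E) (a : hom Q (pt_dom p)) (b : hom Q (pt_cod p')),
     is_pullback a b (pt_epi p) (ph_cod h)) ->
  cartesian Pt_cod h <->
  is_pullback (ph_dom h) (pt_epi p') (pt_epi p) (ph_cod h).
Proof.
intros (Q & a & b & sq & univ); split.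
- intros cart; split; [apply ph_epi|].
  destruct (univ _ (pt_sec p ∘ ph_cod h) (idm (pt_cod p'))) as (s & [as_ bs] & _).
  { now rewrite compA, pt_split, comp1m, compm1. }
  pose (q := @Point Q (pt_cod p') b s bs).
  assert (e2 : a ∘ pt_sec q = pt_sec p ∘ ph_cod h) by exact as_.
  pose (g := @PointHom q p (ph_cod h) a sq e2).
  destruct (cart q g (idm _)) as (k & [kc kg] & _).
  { simpl; now rewrite compm1. }
  simpl in kc.
  assert (ka : ph_dom h ∘ ph_dom k = a).
  { exact (f_equal (fun z : point_hom q p => ph_dom z) kg). }
  assert (kb : pt_epi p' ∘ ph_dom k = b).
  { rewrite ph_epi, kc; apply comp1m. }
  (* the comparison p' -> q over the identity *)
  destruct (univ _ (ph_dom h) (pt_epi p')) as (m & [ma mb] & _).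
  { apply ph_epi. }
  assert (km : ph_dom k ∘ m = idm _).
  { assert (mE : b ∘ m = idm _ ∘ pt_epi p') by now rewrite comp1m.
    assert (mS : m ∘ pt_sec p' = s ∘ idm _).
    { rewrite compm1.
      destruct (univ _ (a ∘ s) (b ∘ s)) as (z & _ & uz).
      { now rewrite !compA, sq. }
      transitivity z; [symmetry|]; apply uz; split; trivial.
      - now rewrite compA, ma, as_, ph_sec.
      - now rewrite compA, mb, pt_split, bs. }
    pose (mm := @PointHom p' q (idm _) m mE mS).
    destruct (cart p' h (idm _)) as (z & _ & uz).
    { apply compm1. }
    assert (e : point_comp k mm = point_id p').
    { transitivity z; [symmetry|]; apply uz; split; simpl; trivial.
      - rewrite kc; apply comp1m.
      - apply point_hom_eq; simpl.
        + rewrite kc, !comp1m; apply compm1.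
        + rewrite compA; transitivity (a ∘ m); trivial.
          exact (f_equal (fun z => z ∘ m) ka).
      - apply point_hom_eq; simpl; apply compm1. }
    exact (f_equal (fun z : point_hom p' p' => ph_dom z) e). }
  intros T c d cd; destruct (univ T c d cd) as (z & [az bz] & uz).
  exists (ph_dom k ∘ z); split; [split|].
  + now rewrite compA, ka.
  + now rewrite compA, kb.
  + intros z' [z1 z2].
    rewrite (uz (m ∘ z')).
    * rewrite compA; transitivity (idm _ ∘ z'); [|apply comp1m].
      exact (f_equal (fun i => i ∘ z') km).
    * now rewrite !compA, ma, mb.
- intros [_ pb] r g k e; simpl in *.
  destruct (pb _ (ph_dom g) (k ∘ pt_epi r)) as (x & [x1 x2] & ux).
  { now rewrite ph_epi, <- e, compA. }
  assert (xs : x ∘ pt_sec r = pt_sec p' ∘ k).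
  { destruct (pb _ (ph_dom g ∘ pt_sec r) k) as (z & _ & uz).
    { now rewrite ph_sec, compA, pt_split, comp1m. }
    transitivity z; [symmetry|]; apply uz; split.
    - now rewrite compA, x1.
    - now rewrite compA, x2, <- compA, pt_split, compm1.
    - now rewrite compA, ph_sec, <- compA, e, <- ph_sec.
    - now rewrite compA, pt_split, comp1m. }
  exists (@PointHom r p' k x x2 xs); split; [split|]; trivial.
  + apply point_hom_eq; trivial.
  + intros h' [h1 h2]; apply point_hom_eq; simpl; [now symmetry|].
    apply ux; split.
    * now rewrite <- h2.
    * now rewrite ph_epi, h1.
Qed.
End Points.

(* Main.v *)
Require Import Defs.
From Stdlib Require Import FinFun List.
Import ListNotations.

(** Write generalized elements as if [E] consisted of sets.  A relation [R] is
    difunctional when [x R y], [x' R y] and [x' R y'] give [x R y'].  For a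
    reflexive [R], the chain [y R y], [x R y], [x R x] then gives [y R x], and
    [x R y], [y R y], [y R z] gives [x R z]; so it is enough that every
    relation is difunctional ([relation_difunctional]).

    Fix the middle pair [(x', y)] of [R].  The possible [x] form a split
    epimorphism over [R], with section [x = x'], and the possible [y'] form
    another one, with section [y' = y].  In the pullback of the two, the
    subobject of those [(x, y')] with [x R y'] contains the images of both
    sections of the pullback.  So difunctionality reduces to
    [sections_cover_split_pullback]: a subobject [R] of the pullback [P] of two
    split epimorphisms [X -> Y] and [Z -> Y] which contains both sections is
    all of [P].

    This is where decomposability enters.  View [R] inside [P] as a
    monomorphism of points over [Z], with fibres [R_z] inside [P_z], and let
    [(U, u, w)] be its extremal decomposition.  Over pairs [(z, z')] with the
    same image in [Y] there are two families extending [R] from the diagonal: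
    [S'], with fibre [R_z'], and its subfamily [S], with fibre the intersection
    of [R_z] and [R_z'].  Both are decompositions of the same monomorphism,
    with base component [(z, z') |-> z], so each has a unique comparison to
    [U].  The comparison of [S] is the restriction of the comparison of [S'],
    but it is also the composite of [S -> R, (x, z, z') |-> (x, z)] with [u].
    Since [S] and [S'] have the same base, the comparison [S' -> U] lies over
    [(z, z') |-> u z], and, as [u] is cartesian, it carries [R_z'] into [R_z]
    whenever [z] and [z'] have the same image in [Y].  For [z'] on the section
    of [Z -> Y], the fibre [R_z'] is everything, hence so is every [R_z]. *)

Set Implicit Arguments.
Unset Strict Implicit.
Unset Printing Implicit Defensive.

Local Open Scope cat_scope.

(** * Equational reasoning in a category *)

Lemma comp_whisker (E : category) (X Y Z : E) (g : hom Y Z) (f : hom X Y)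
    (h : hom X Z) :
  g ∘ f = h -> forall (T : E) (k : hom T X), g ∘ (f ∘ k) = h ∘ k.
Proof. now intros <- T k; rewrite compA. Qed.

(** Diagram chase by rewriting: composites are kept right-nested, and every
    equation of the context whose left side is a composite is used from left to
    right, also in front of a further factor.  The equations of the context must
    therefore simplify in that direction, hence the [clear]s and the flipped
    equations in the proofs that use it. *)
Ltac chase :=
  rewrite <- ?compA;
  repeat (first
    [ rewrite comp1m | rewrite compm1
    | match goal with
      | H : _ ∘ _ = _ |- _ => first [ rewrite H | rewrite (comp_whisker H) ]
      end ];
    rewrite <- ?compA);
  try reflexivity.

(** * Pullbacks and products from finite limits *)

Inductive cospan_ob := cleft | cright | capex.

Definition cospan_hom (i j : cospan_ob) : Type :=
  match i, j with
  | cleft, cleft | cright, cright | capex, capex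
  | cleft, capex | cright, capex => unit
  | _, _ => Empty_set
  end.

Definition cospan : category.
Proof.
refine (@Category cospan_ob cospan_hom
  (fun i => match i with cleft | cright | capex => tt end)
  (fun i j k => match i, j, k with
     | cleft, cleft, _ | cright, cright, _ | capex, capex, _ => fun b _ => b
     | cleft, capex, capex | cright, capex, capex => fun _ a => a
     | _, _, _ => _ end) _ _ _).
Unshelve.
all: try (intros [] []; fail); try (intros _ []; fail); try (intros [] _; fail).
- intros [] []; simpl; try intros []; reflexivity.
- intros [] []; simpl; try intros []; reflexivity.
- intros [] [] [] []; simpl; intros; repeat match goal with
  x : unit |- _ => destruct x | x : Empty_set |- _ => destruct x end; reflexivity.
Defined.

Lemma cospan_finite : finite_category cospan.
Proof.
split.
- exists [cleft; cright; capex]; intros []; simpl; auto.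
- intros [] []; simpl;
    first [ exists [tt]; intros []; simpl; now auto | exists []; intros [] ].
Qed.

Definition cospan_functor (E : category) (A B C : E) (f : hom A C)
    (g : hom B C) : functor cospan E.
Proof.
refine (@Functor cospan E
  (fun i => match i with cleft => A | cright => B | capex => C end)
  (fun i j => match i, j with
     | cleft, cleft => fun _ => idm A
     | cright, cright => fun _ => idm B
     | capex, capex => fun _ => idm C
     | cleft, capex => fun _ => f
     | cright, capex => fun _ => g
     | _, _ => _ end) _ _).
Unshelve.
all: try (intros []; fail).
- intros []; reflexivity.
- intros [] [] []; simpl; intros [] []; now rewrite ?comp1m, ?compm1.
Defined.

Lemma has_pullbacks (E : category) (A B C : E) (f : hom A C) (g : hom B C) :
  finitely_complete E ->
  exists (P : E) (p : hom P A) (q : hom P B), is_pullback p q f g.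
Proof.
intros fc.
destruct (fc _ (cospan_functor f g) cospan_finite) as (L & p & cone & univ).
exists L, (p cleft), (p cright); split.
- transitivity (p capex).
  + exact (cone cleft capex tt).
  + symmetry; exact (cone cright capex tt).
- intros T a b ab.
  (* the leg to the apex is forced by the other two *)
  pose (q := fun j : cospan =>
    match j return hom T (cospan_functor f g j) with
    | cleft => a | cright => b | capex => f ∘ a end).
  destruct (univ T q) as (h & hq & uh).
  { intros [] []; simpl; intros []; now rewrite ?comp1m. }
  exists h; split.
  + split; [exact (hq cleft) | exact (hq cright)].
  + intros h' [h1 h2]; apply uh; intros []; trivial.
    transitivity (f ∘ p cleft ∘ h').
    * exact (f_equal (fun z => z ∘ h') (eq_sym (cone cleft capex tt))).
    * now rewrite <- compA, h1.
Qed.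

Definition empty_category : category.
Proof.
now refine (@Category Empty_set (fun _ _ => Empty_set)
  (fun X => match X with end) (fun X => match X with end) _ _ _).
Defined.

Lemma has_terminal (E : category) :
  finitely_complete E ->
  exists One : E, forall T : E, exists! h : hom T One, True.
Proof.
intros fc.
assert (D : functor empty_category E).
{ now refine (@Functor empty_category E (fun X => match X with end)
    (fun X => match X with end) _ _). }
destruct (fc _ D) as (L & p & _ & univ).
{ split; [exists []; intros [] | intros []]. }
exists L; intros T; destruct (univ T (fun j => match j with end)) as (h & _ & uh).
{ intros []. }
exists h; split; trivial.
now intros h' _; apply uh; intros [].
Qed.

(** A product is a pullback over the terminal object. *)
Lemma has_products (E : category) (A B : E) :
  finitely_complete E ->
  exists (P : E) (p : hom P A) (q : hom P B),
    forall (T : E) (a : hom T A) (b : hom T B),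
      exists! h : hom T P, p ∘ h = a /\ q ∘ h = b.
Proof.
intros fc; destruct (has_terminal fc) as (One & term).
destruct (term A) as (f & _ & _), (term B) as (g & _ & _).
destruct (has_pullbacks f g fc) as (P & p & q & _ & univ).
exists P, p, q; intros T a b; apply univ.
destruct (term T) as (z & _ & uz).
now rewrite <- (uz (f ∘ a)), <- (uz (g ∘ b)).
Qed.

Lemma pullback_ext (E : category) (P A B C : E) (p : hom P A) (q : hom P B)
    (f : hom A C) (g : hom B C) (T : E) (h k : hom T P) :
  is_pullback p q f g -> p ∘ h = p ∘ k -> q ∘ h = q ∘ k -> h = k.
Proof.
intros [sq univ] pe qe.
destruct (univ T (p ∘ k) (q ∘ k)) as (z & _ & uz).
{ now rewrite !compA, sq. }
transitivity z; [symmetry|]; apply uz; auto.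
Qed.

(** * Split epimorphisms and their pullbacks *)

(** In this direction the square itself witnesses that the pullback exists. *)
Lemma pullback_cartesian (E : category) (p' p : Pt E) (h : hom p' p) :
  is_pullback (ph_dom h) (pt_epi p') (pt_epi p) (ph_cod h) ->
  cartesian (Pt_cod E) h.
Proof.
intros pb; apply cartesian_Pt_codP; trivial.
now exists (pt_dom p'), (ph_dom h), (pt_epi p').
Qed.

(** The pullback of two split epimorphisms is generated by its two sections.
    The sections of the points over [N], the object of pairs [(z, z')], are all
    built from [b], because [b z] lies over [s (g z)], which depends only on
    the common image of [z] and [z']: this is why the pairs are taken over
    [Y].  The section [a] places every [x], whatever [z] it was paired with,
    in the fibre of [R] over [t (f x)]. *)
Lemma sections_cover_split_pullback (E : category) (X Y Z P R : E)
    (f : hom X Y) (s : hom Y X) (g : hom Z Y) (t : hom Y Z)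
    (p : hom P X) (q : hom P Z) (m : hom R P) (a : hom X R) (b : hom Z R) :
  finitely_complete E -> decomposable (Pt_cod E) ->
  f ∘ s = idm Y -> g ∘ t = idm Y -> is_pullback p q f g -> mono m ->
  p ∘ m ∘ a = idm X -> q ∘ m ∘ a = t ∘ f ->
  p ∘ m ∘ b = s ∘ g -> q ∘ m ∘ b = idm Z ->
  exists k : hom P R, m ∘ k = idm P.
Proof.
intros fc dec fs gt pbP mm pa qa pb qb.
assert (fp : f ∘ p = g ∘ q) by apply pbP.
remember (p ∘ m) as rho eqn:Erho; symmetry in Erho.
remember (q ∘ m) as zeta eqn:Ezeta; symmetry in Ezeta.
assert (fr : f ∘ rho = g ∘ zeta) by (rewrite <- Erho, <- Ezeta; chase).
pose (Rp := Point qb : Pt E).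
pose (Pp := @Point E P Z q (m ∘ b) ltac:(chase) : Pt E).
pose (v := @PointHom E Rp Pp (idm Z) m ltac:(simpl; chase) ltac:(simpl; chase)
  : hom Rp Pp).
destruct (dec Rp Pp v) as (U & u & w & [vwu ucart] & ext).
{ intros T x y e; apply point_hom_eq.
  - pose proof (f_equal (fun z : hom T Pp => ph_cod z) e) as e1; simpl in e1.
    now rewrite !comp1m in e1.
  - apply mm; exact (f_equal (fun z : hom T Pp => ph_dom z) e). }
assert (vd : ph_dom w ∘ ph_dom u = m)
  by exact (f_equal (fun z : hom Rp Pp => ph_dom z) (eq_sym vwu)).
(* [N] is the object of pairs [(z, z')], [dN] its diagonal; [S] consists of
   the [(x, z, z')] with [(x, z)] and [(x, z')] in [R], and [S'] of those with
   [(x, z')] in [R]. *)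
destruct (has_pullbacks g g fc) as (N & n0 & n1 & pbN).
assert (gn : g ∘ n1 = g ∘ n0) by (symmetry; apply pbN).
destruct (proj2 pbN Z (idm Z) (idm Z) eq_refl) as (dN & [dN0 dN1] & _).
destruct (has_pullbacks rho rho fc) as (S & r0 & r1 & pbS).
assert (rS : rho ∘ r1 = rho ∘ r0) by (symmetry; apply pbS).
destruct (has_pullbacks zeta n1 fc) as (S' & c & e & pbS').
assert (zc : zeta ∘ c = n1 ∘ e) by apply pbS'.
(* [S] over [N], extending [R] along the diagonal *)
destruct (proj2 pbN S (zeta ∘ r0) (zeta ∘ r1)) as (eS & [eS0 eS1] & _).
{ rewrite !compA, <- fr, <- !compA, rS; reflexivity. }
destruct (proj2 pbS N (b ∘ n0) (b ∘ n1)) as (sS & [sS0 sS1] & _).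
{ chase. }
assert (sSp : eS ∘ sS = idm N).
{ apply (pullback_ext pbN); chase. }
pose (Sp := Point sSp : Pt E).
destruct (proj2 pbS R (idm R) (idm R) eq_refl) as (dS & [dS0 dS1] & _).
assert (uSe : eS ∘ dS = dN ∘ zeta) by (apply (pullback_ext pbN); chase).
assert (uSs : dS ∘ b = sS ∘ dN) by (apply (pullback_ext pbS); chase).
pose (uS := @PointHom E Rp Sp dN dS uSe uSs : hom Rp Sp).
assert (uScart : cartesian (Pt_cod E) uS).
{ apply pullback_cartesian; split; [exact uSe|]; simpl.
  intros T x y xy.
  assert (z0 : zeta ∘ (r0 ∘ x) = y).
  { transitivity (n0 ∘ (eS ∘ x)); [clear xy; chase | rewrite xy; chase]. }
  assert (z1 : zeta ∘ (r1 ∘ x) = y).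
  { transitivity (n1 ∘ (eS ∘ x)); [clear xy; chase | rewrite xy; chase]. }
  (* over the diagonal the two elements of [R] agree in [P] *)
  assert (r01 : r0 ∘ x = r1 ∘ x).
  { apply mm, (pullback_ext pbP); chase; congruence. }
  exists (r0 ∘ x); split; [split|]; trivial.
  - apply (pullback_ext pbS); chase.
  - intros h [<- _]; chase. }
(* [S'] over [N], also extending [R] along the diagonal *)
destruct (proj2 pbS' N (b ∘ n1) (idm N)) as (sS' & [sS'0 sS'1] & _).
{ chase. }
pose (Sp' := Point sS'1 : Pt E).
destruct (proj2 pbS' R (idm R) (dN ∘ zeta)) as (dS' & [dS'0 dS'1] & _).
{ chase. }
assert (uS's : dS' ∘ b = sS' ∘ dN) by (apply (pullback_ext pbS'); chase).
pose (uS' := @PointHom E Rp Sp' dN dS' dS'1 uS's : hom Rp Sp').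
assert (uS'cart : cartesian (Pt_cod E) uS').
{ apply pullback_cartesian; split; [exact dS'1|]; simpl.
  intros T x y xy.
  assert (z1 : zeta ∘ (c ∘ x) = y).
  { transitivity (n1 ∘ (e ∘ x)); [clear xy; chase | rewrite xy; chase]. }
  exists (c ∘ x); split; [split|]; trivial.
  - apply (pullback_ext pbS'); chase.
  - intros h [<- _]; chase. }
(* [S'] maps to [P] by [(x, z, z') |-> (x, z)], and on [S] this map lands in
   [R]. *)
destruct (proj2 pbP S' (rho ∘ c) (n0 ∘ e)) as (wS'd & [wS'0 wS'1] & _).
{ chase. }
assert (wS's : wS'd ∘ sS' = (m ∘ b) ∘ n0) by (apply (pullback_ext pbP); chase).
pose (wS' := @PointHom E Sp' Pp n0 wS'd wS'1 wS's : hom Sp' Pp).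
pose (wS := @PointHom E Sp Rp n0 r0 (eq_sym eS0) sS0 : hom Sp Rp).
destruct (proj2 pbS' S r1 eS) as (jd & [jd0 jd1] & _).
{ chase. }
assert (js : jd ∘ sS = sS' ∘ idm N) by (apply (pullback_ext pbS'); chase).
pose (j := @PointHom E Sp Sp' (idm N) jd ltac:(simpl; chase) js : hom Sp Sp').
destruct (ext Sp' uS' wS') as (tt' & [wt tu] & _).
{ split; trivial. apply point_hom_eq; simpl; [now rewrite dN0|].
  apply (pullback_ext pbP); chase. }
destruct (ext Sp uS (v ∘ wS)) as (ts & _ & uts).
{ split; trivial. apply point_hom_eq; simpl; chase. }
(* uniqueness of the comparison from [S] identifies its two descriptions *)
assert (key : tt' ∘ j = u ∘ wS).
{ transitivity ts; [symmetry|]; apply uts; split.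
  - rewrite compA, wt. apply point_hom_eq; simpl; [chase|].
    apply (pullback_ext pbP); chase.
  - rewrite <- tu, <- compA. f_equal.
    apply point_hom_eq; simpl; [chase|].
    apply (pullback_ext pbS'); chase.
  - now rewrite compA, <- vwu.
  - rewrite <- compA. transitivity (u ∘ idm Rp); [f_equal|apply compm1].
    apply point_hom_eq; simpl; chase. }
(* [S] and [S'] have the same base, so [key] determines the base component of
   the comparison from [S'] itself. *)
assert (tc : ph_cod tt' = ph_cod u ∘ n0).
{ rewrite <- (compm1 (ph_cod tt')).
  exact (f_equal (fun z : hom Sp U => ph_cod z) key). }
assert (wtd : ph_dom w ∘ ph_dom tt' = wS'd)
  by exact (f_equal (fun z : hom Sp' Pp => ph_dom z) wt).
(* [P] embeds in [S'] by [(x, z) |-> (x, z, t (f x))], thanks to [a]. *)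
destruct (proj2 pbN P q (t ∘ (f ∘ p))) as (nP & [nP0 nP1] & _).
{ chase. }
destruct (proj2 pbS' P (a ∘ p) nP) as (l & [l0 l1] & _).
{ chase. }
assert (ue := ph_epi tt'); simpl in ue.
destruct (has_pullbacks (pt_epi U) (ph_cod u) fc) as (Q & x & y & pbQ).
assert (upb : is_pullback (ph_dom u) zeta (pt_epi U) (ph_cod u)).
{ apply (@cartesian_Pt_codP E Rp U u); trivial. now exists Q, x, y. }
(* The image of [P] in [U] lies over [u z], so it lifts to [R] along [u]. *)
destruct (proj2 upb P (ph_dom tt' ∘ l) q) as (k & [k0 k1] & _).
{ rewrite tc in ue; rewrite compA.
  transitivity (ph_cod u ∘ n0 ∘ e ∘ l).
  - exact (f_equal (fun i => i ∘ l) ue).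
  - rewrite <- !compA, l1. exact (f_equal (comp (ph_cod u)) nP0). }
exists k.
rewrite <- vd, <- compA. transitivity (wS'd ∘ l).
{ rewrite k0, compA. f_equal. exact wtd. }
apply (pullback_ext pbP); clear key tc; chase.
Qed.

(** * Difunctional relations *)

Definition difunctional (E : category) (R A B : E) (d0 : hom R A)
    (d1 : hom R B) : Prop :=
  forall (T : E) (x y z : hom T R), d1 ∘ x = d1 ∘ y -> d0 ∘ y = d0 ∘ z ->
    exists r : hom T R, d0 ∘ r = d0 ∘ x /\ d1 ∘ r = d1 ∘ z.

(** With [(x', y)] in [R] as base, the pairs [(x, y')] with [x R y'] contain
    both sections of the pullback of [{x | x R y}] and [{y' | x' R y'}], and
    [sections_cover_split_pullback] leaves no other possibility than all
    pairs. *)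
Lemma relation_difunctional (E : category) (R A : E) (d0 d1 : hom R A) :
  finitely_complete E -> decomposable (Pt_cod E) ->
  is_relation d0 d1 -> difunctional d0 d1.
Proof.
intros fc dec rel.
(* [X] classifies the [x R y, x' R y], [Z] the [x' R y, x' R y'], [P] the
   composable zigzags, and [Q] those zigzags with [x R y']. *)
destruct (has_pullbacks d1 d1 fc) as (X & x & y & pbX).
destruct (has_pullbacks d0 d0 fc) as (Z & y' & z & pbZ).
destruct (has_pullbacks y y' fc) as (P & p & q & pbP).
destruct (has_products A A fc) as (AA & a0 & a1 & prod).
destruct (prod R d0 d1) as (d & [ad0 ad1] & _).
destruct (prod P (d0 ∘ (x ∘ p)) (d1 ∘ (z ∘ q))) as (xz & [xz0 xz1] & _).
destruct (has_pullbacks xz d fc) as (Q & m & r & pbQ).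
assert (xy : d1 ∘ x = d1 ∘ y) by apply pbX.
assert (yz : d0 ∘ z = d0 ∘ y') by (symmetry; apply pbZ).
assert (pq : y ∘ p = y' ∘ q) by apply pbP.
assert (mr : d ∘ r = xz ∘ m) by (symmetry; apply pbQ).
assert (ext : forall (T : E) (h k : hom T AA),
  a0 ∘ h = a0 ∘ k -> a1 ∘ h = a1 ∘ k -> h = k).
{ intros T h k e0 e1. destruct (prod T (a0 ∘ k) (a1 ∘ k)) as (i & _ & ui).
  transitivity i; [symmetry|]; apply ui; auto. }
assert (r0 : d0 ∘ r = d0 ∘ (x ∘ (p ∘ m))).
{ rewrite <- ad0, <- compA, mr; chase. }
assert (r1 : d1 ∘ r = d1 ∘ (z ∘ (q ∘ m))).
{ rewrite <- ad1, <- compA, mr; chase. }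
destruct (proj2 pbX R (idm R) (idm R) eq_refl) as (s & [xs ys] & _).
destruct (proj2 pbZ R (idm R) (idm R) eq_refl) as (t & [yt zt] & _).
destruct (proj2 pbP X (idm X) (t ∘ y)) as (i & [pi qi] & _); [chase|].
destruct (proj2 pbP Z (s ∘ y') (idm Z)) as (j & [pj qj] & _); [chase|].
(* on the section [y' = y] the required pair is [(x, y)], on [x = x'] it is
   [(x', y')] *)
destruct (proj2 pbQ X i x) as (a & [ma ra] & _).
{ apply ext; clear mr r0 r1; chase. }
destruct (proj2 pbQ Z j z) as (b & [mb rb] & _).
{ apply ext; clear mr r0 r1; chase. }
destruct (@sections_cover_split_pullback E X R Z P Q y s y' t p q m a b)
  as (k & mk); trivial.
{ intros T h h' e. apply (pullback_ext pbQ); trivial.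
  apply rel; rewrite !compA.
  - rewrite r0, <- !compA, e; reflexivity.
  - rewrite r1, <- !compA, e; reflexivity. }
1-4: clear mr r0 r1; chase.
intros T x1 y1 z1 e0 e1.
destruct (proj2 pbX T x1 y1 e0) as (h & [xh yh] & _).
destruct (proj2 pbZ T y1 z1 e1) as (h' & [yh' zh'] & _).
destruct (proj2 pbP T h h') as (i' & [ph qh] & _); [now rewrite yh|].
exists (r ∘ (k ∘ i')); split.
- rewrite compA, r0, <- !compA, (comp_whisker mk). clear r0 r1 mr xy yz e0 e1.
  chase.
- rewrite compA, r1, <- !compA, (comp_whisker mk). clear r0 r1 mr xy yz e0 e1.
  chase.
Qed.

(** From the zigzag [y R y], [x R y], [x R x]. *)
Lemma difunctional_symmetric (E : category) (R A : E) (d0 d1 : hom R A) :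
  difunctional d0 d1 -> reflexive_rel d0 d1 -> symmetric_rel d0 d1.
Proof.
intros dif (s0 & e0 & e1).
destruct (dif R (s0 ∘ d1) (idm R) (s0 ∘ d0)) as (c & c0 & c1); [chase..|].
exists c; split; chase.
Qed.

(** From the zigzag [x R y], [y R y], [y R z]. *)
Lemma difunctional_transitive (E : category) (R A : E) (d0 d1 : hom R A) :
  difunctional d0 d1 -> reflexive_rel d0 d1 -> transitive_rel d0 d1.
Proof.
intros dif (s0 & e0 & e1) P p0 p1 [sq _].
destruct (dif P p0 (s0 ∘ (d1 ∘ p0)) p1) as (c & c0 & c1); [chase..|].
now exists c.
Qed.

(** * Decomposability implies the Mal'tsev property *)

Theorem corollary2p1 (E : category) :
  finitely_complete E -> decomposable (Pt_cod E) -> maltsev_category E.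
Proof.
intros fc dec; split; trivial.
intros R X d0 d1 [rel refl].
pose proof (relation_difunctional fc dec rel) as dif.
repeat split; trivial.
- now apply difunctional_symmetric.
- now apply difunctional_transitive.
Qed.
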